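(* Let $\{K_{ij}\}_{i,j\in I}$ be a time-scaled intertwining cocycle with scaling factors $\{\lambda_{ij}\}_{i,j\in I}$, $\lambda_{ij}>0$, for the semigroups $\mathcal S_i(t)=e^{-tA_i}$. Then there exists a family $\{\tau_i\}_{i\in I}$ with $\tau_i>0$ such that $$\lambda_{ij}=\frac{\tau_i}{\tau_j}\qquad\text{for all } i,j\in I.$$ (Equivalently, the scaling cocycle $\lambda$ is a multiplicative coboundary.)
   Context: Setting. $I$ is an index set. For each $i\in I$: $\mathcal H_i$ is a separable complex Hilbert space; $A_i$ is a positive (i.e. $\langle A_iu,u\rangle\ge 0$ for $u\in\mathrm{Dom}(A_i)$) self-adjoint operator on $\mathcal H_i$ with compact resolvent; $\mathcal S_i(t)=e^{-tA_i}$, $t\ge0$, is the associated strongly continuous contraction semigroup. Each sector is nontrivial: $\sigma(A_i)$ contains at least one strictly positive eigenvalue. Definition. A family of bounded injective operators $K_{ij}:\mathcal H_j\to\mathcal H_i$ ($i,j\in I$) is a time-scaled intertwining cocycle with scaling factors $\lambda_{ij}>0$ if for all $i,j,k\in I$: $K_{ik}=K_{ij}K_{jk}$, and $K_{ij}\mathcal S_j(t)=\mathcal S_i(\lambda_{ij}t)K_{ij}$ for all $t\ge0$. *)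

(* Defs.v *)
From mathcomp Require Import all_boot all_order all_algebra.
From mathcomp Require Import sesquilinear complex.
From mathcomp Require Import all_classical all_reals all_analysis.

Set Implicit Arguments.
Unset Strict Implicit.
Unset Printing Implicit Defensive.

Import Order.TTheory GRing.Theory Num.Theory.
Import numFieldNormedType.Exports.

Local Open Scope classical_set_scope.
Local Open Scope complex_scope.
Local Open Scope ring_scope.

(* The inner product is linear in the first and conjugate-linear in the second
   argument; norms take their values in [R[i]]. *)
Record hilbertSpace (R : realType) := HilbertSpace {
  hilbert_sort :> completeNormedModType R[i];
  inner : {dot hilbert_sort for (@Num.conj R[i])};
  inner_normE : forall u : hilbert_sort, `|u| ^+ 2 = inner u u }.

Definition separable_space (T : topologicalType) : Prop :=
  exists2 D : set T, countable D & dense D.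

Section Operators.
Context {R : realType}.
Implicit Types H : hilbertSpace R.

Definition bounded_operator {H1 H2 : hilbertSpace R}
    (T : {linear H1 -> H2}) : Prop :=
  exists M : R, forall u : H1, `|T u| <= M%:C * `|u|.

Definition compact_operator {H1 H2 : hilbertSpace R}
    (T : {linear H1 -> H2}) : Prop :=
  precompact (T @` [set u : H1 | `|u| <= 1]).

(* The values of [uop_fun] outside [dom] are irrelevant. *)
Record unbounded_operator (H : hilbertSpace R) := UnboundedOperator {
  dom : set H;
  uop_fun :> H -> H;
  dom0 : dom 0;
  domP : forall (a : R[i]) u v, dom u -> dom v -> dom (a *: u + v);
  uop_linear : forall (a : R[i]) u v, dom u -> dom v ->
    uop_fun (a *: u + v) = a *: uop_fun u + uop_fun v }.

Section OneOperator.
Context {H : hilbertSpace R}.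
Variable A : unbounded_operator H.

Definition adjoint_graph (v w : H) : Prop :=
  forall u, dom A u -> inner H (A u) v = inner H u w.

Definition self_adjoint : Prop :=
  dense (dom A) /\
  forall v w, adjoint_graph v w <-> dom A v /\ w = A v.

(* The order of [R[i]] makes [0 <= z] mean that [z] is real and nonnegative. *)
Definition positive_operator : Prop :=
  forall u, dom A u -> 0 <= inner H (A u) u.

Definition is_resolvent (z : R[i]) (T : {linear H -> H}) : Prop :=
  [/\ bounded_operator T,
      forall u, dom A (T u) /\ z *: T u - A (T u) = u
    & forall u, dom A u -> T (z *: u - A u) = u].

Definition resolvent_set : set R[i] := [set z | exists T, is_resolvent z T].

Definition spectrum : set R[i] := ~` resolvent_set.

(* By the resolvent identity, compactness at one point of the resolvent set
   is equivalent to compactness at all of them. *)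
Definition compact_resolvent : Prop :=
  exists z T, is_resolvent z T /\ compact_operator T.

Definition eigenvalue_of (z : R[i]) : Prop :=
  exists u, [/\ dom A u, u != 0 & A u = z *: u].

Definition nontrivial_sector : Prop :=
  exists mu : R, [/\ 0 < mu, spectrum mu%:C & eigenvalue_of mu%:C].

End OneOperator.

(* One-parameter families are indexed by [R]; only times [0 <= t] matter. *)
Record contraction_semigroup {H} (S : R -> {linear H -> H}) : Prop := {
  semigroup0 : forall u, S 0 u = u;
  semigroupD : forall s t u, 0 <= s -> 0 <= t -> S (s + t) u = S s (S t u);
  semigroup_contraction : forall t u, 0 <= t -> `|S t u| <= `|u|;
  semigroup_strongly_continuous : forall u, S t u @[t --> 0^'+] --> u }.

Definition generator_graph {H} (S : R -> {linear H -> H}) (u v : H) : Prop :=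
  (h^-1)%:C *: (S h u - u) @[h --> 0^'+] --> v.

(* [S t = e^{-tA}]: [S] is the strongly continuous contraction semigroup whose
   infinitesimal generator is [-A], domains included. *)
Definition semigroup_of {H} (A : unbounded_operator H)
    (S : R -> {linear H -> H}) : Prop :=
  contraction_semigroup S /\
  forall u v, generator_graph S u v <-> dom A u /\ v = - A u.

Record time_scaled_intertwining_cocycle {I : Type} {H : I -> hilbertSpace R}
    (S : forall i, R -> {linear H i -> H i})
    (K : forall i j, {linear H j -> H i}) (lambda : I -> I -> R) : Prop := {
  cocycle_bounded : forall i j, bounded_operator (K i j);
  cocycle_injective : forall i j, injective (K i j);
  cocycle_scaling_gt0 : forall i j, 0 < lambda i j;
  cocycleM : forall i j k (u : H k), K i k u = K i j (K j k u);
  cocycle_intertwining : forall i j t (u : H j), 0 <= t ->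
    K i j (S j t u) = S i (lambda i j * t) (K i j u) }.

End Operators.

(* Main.v *)
Require Import Defs.
From mathcomp Require Import all_boot all_order all_algebra.
From mathcomp Require Import sesquilinear complex.
From mathcomp Require Import all_classical all_reals all_analysis.
Import Order.TTheory GRing.Theory Num.Theory.
Import numFieldNormedType.Exports.
Local Open Scope ring_scope.

(* If a bounded operator [B] satisfies [B S(t) = T(c t) B], differentiating at
   [t = 0+] shows that [B] maps an eigenvector [u] of [A], with eigenvalue
   [mu], to a vector [v] on which the generator of [T] is [- mu / c]. Both
   [lambda i k] and [lambda i j * lambda j k] are such a factor [c] for
   [B = K i k], and [v != 0] by injectivity; uniqueness of limits
   makes them equal. Then [tau i := lambda i i0] works for any fixed [i0]. *)

Local Open Scope classical_set_scope.
Local Open Scope complex_scope.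

(** Allows rescaling of time in a limit at [0^'+]: as [c] is positive, [c * h] stays on the right of
    0. *)
Lemma cvg_at_right0Ml {R : realType} (c : R) (c_gt0 : 0 < c) :
  c * h @[h --> (0 : R)^'+] --> (0 : R)^'+.
Proof.
have c_cvg0 : c * h @[h --> (0 : R)] --> (0 : R).
  by rewrite -[X in _ --> X](mulr0 c); exact: mulrl_continuous.
move=> P P0.
have cP : \forall h \near (0 : R), 0 < c * h -> P (c * h) by exact: c_cvg0 P0.
apply: filterS cP => h /= Pch h_gt0.
by apply: Pch; rewrite mulr_gt0.
Qed.

Lemma bounded_operator_continuous {R : realType} {H1 H2 : hilbertSpace R}
    {T : {linear H1 -> H2}} : bounded_operator T -> continuous T.
Proof.
move=> [M TM]; apply/linear_bounded_continuous/linear_boundedP.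
near=> r => u; apply: le_trans (TM u) _; rewrite ler_wpM2r//.
(* The order of [R[i]] is partial: large [r] dominate [M%:C] because the latter is real. *)
near: r; apply: nbhs_pinfty_ge.
by rewrite complex_real.
Unshelve. all: by end_near.
Qed.

(** The difference quotient of [S2] at [B u] with step [h] is [c^-1] times the image under [B] of
    the quotient of [S1] at [u] with step [c^-1 * h]; continuity of [B] gives the limit. *)
Lemma generator_graph_intertwining {R : realType} {H1 H2 : hilbertSpace R}
    {S1 : R -> {linear H1 -> H1}} {S2 : R -> {linear H2 -> H2}}
    {B : {linear H1 -> H2}} {c : R} {u w : H1} :
  bounded_operator B -> 0 < c ->
  (forall t v, 0 <= t -> B (S1 t v) = S2 (c * t) (B v)) ->
  generator_graph S1 u w -> generator_graph S2 (B u) ((c^-1)%:C *: B w).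
Proof.
move=> bB c_gt0 BS Su.
have civ_gt0 : 0 < c^-1 by rewrite invr_gt0.
pose q h := B ((h^-1)%:C *: (S1 h u - u)).
have cvB : q h @[h --> (0 : R)^'+] --> B w.
  exact: (continuous_cvg _ (bounded_operator_continuous bB w) Su).
have cvq : (c^-1)%:C *: q (c^-1 * h) @[h --> (0 : R)^'+] --> (c^-1)%:C *: B w.
  exact: (cvgZl_tmp (cvg_comp _ q (cvg_at_right0Ml c^-1 civ_gt0) cvB)).
apply: cvg_trans cvq; apply: near_eq_cvg; near=> h => /=.
have h_gt0 : 0 < h by [].
rewrite /q linearZ/= linearB/= BS; last by rewrite ltW// mulr_gt0.
rewrite scalerA -rmorphM/=; congr (_%:C *: (S2 _ _ - _)).
  by rewrite invfM invrK mulrA mulVf ?gt_eqF// mul1r.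
by rewrite mulrA mulfV ?gt_eqF// mul1r.
Unshelve. all: by end_near.
Qed.

Lemma generator_graph_unique {R : realType} {H : hilbertSpace R}
    {S : R -> {linear H -> H}} {u v w : H} :
  generator_graph S u v -> generator_graph S u w -> v = w.
Proof. exact/cvg_unique/norm_hausdorff. Qed.

Lemma scaling_cocycleM {R : realType} {I : Type} {H : I -> hilbertSpace R}
    {A : forall i, unbounded_operator (H i)}
    {S : forall i, R -> {linear H i -> H i}}
    {K : forall i j, {linear H j -> H i}} {lambda : I -> I -> R}
    (S_semigroup : forall i, semigroup_of (A i) (S i))
    (A_nontrivial : forall i, nontrivial_sector (A i))
    (K_cocycle : time_scaled_intertwining_cocycle S K lambda) (i j k : I) :
  lambda i k = lambda i j * lambda j k.
Proof.
case: K_cocycle => bK injK l_gt0 KM KS.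
have [mu [mu_gt0 _ [u [dom_u u_neq0 Au]]]] := A_nontrivial k.
have Su : generator_graph (S k) u (- (mu%:C *: u)).
  by apply/(S_semigroup k).2; rewrite Au.
(* Factor [K i k] through [H j], intertwine twice, then recombine. *)
have KS' t v : 0 <= t ->
    K i k (S k t v) = S i (lambda i j * lambda j k * t) (K i k v).
  move=> t_ge0; rewrite (KM i j k) KS// KS ?mulr_ge0// ?ltW// -mulrA.
  by rewrite -KM.
have l2_gt0 : 0 < lambda i j * lambda j k by rewrite mulr_gt0.
have := generator_graph_unique
  (generator_graph_intertwining (bK i k) (l_gt0 i k) (KS i k) Su)
  (generator_graph_intertwining (bK i k) l2_gt0 KS' Su).
(* Strict positivity of [mu] enters here: for a zero eigenvalue both limits would vanish and say
   nothing about the factors. *)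
have Kw_neq0 : K i k (- (mu%:C *: u)) != 0.
  rewrite -(linear0 (K i k)) (inj_eq (injK i k)) oppr_eq0 scaler_eq0.
  by rewrite negb_or u_neq0 andbT fmorph_eq0 gt_eqF.
move=> /eqP; rewrite -subr_eq0 -scalerBl scaler_eq0 (negbTE Kw_neq0) orbF.
by rewrite subr_eq0 => /eqP/complexI/invr_inj.
Qed.

Local Close Scope complex_scope.
Local Close Scope classical_set_scope.

Theorem theorem2p4 (R : realType) (I : Type) (H : I -> hilbertSpace R)
    (A : forall i : I, unbounded_operator (H i))
    (S : forall i : I, R -> {linear H i -> H i})
    (K : forall i j : I, {linear H j -> H i})
    (lambda : I -> I -> R)
    (H_separable : forall i : I, separable_space (H i))
    (A_self_adjoint : forall i : I, self_adjoint (A i))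
    (A_positive : forall i : I, positive_operator (A i))
    (A_compact_resolvent : forall i : I, compact_resolvent (A i))
    (S_semigroup : forall i : I, semigroup_of (A i) (S i))
    (A_nontrivial : forall i : I, nontrivial_sector (A i))
    (K_cocycle : time_scaled_intertwining_cocycle S K lambda) :
  exists tau : I -> R,
    (forall i : I, 0 < tau i) /\
    (forall i j : I, lambda i j = tau i / tau j).
Proof.
have lM := scaling_cocycleM S_semigroup A_nontrivial K_cocycle.
have l_gt0 := cocycle_scaling_gt0 K_cocycle.
(* A base index exists only if [I] is inhabited; otherwise any [tau] works vacuously. *)
have [[i0]|I_empty] := pselect (inhabited I); last first.
  by exists (fun=> 1); split=> i; case: I_empty.
exists (fun i => lambda i i0); split=> [i|i j]; first exact: l_gt0.
(* Expanding [lambda i i0] through [j] makes [lambda j i0] cancel. *)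
by rewrite (lM i j i0) mulfK// gt_eqF.
Qed.
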